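(* Let $n,m\ge 1$ and let $M=(\mathbb{C}^* )^{mn}$ be the set of $n$ by $m$ matrices ($n$ rows, $m$ columns) with entries in $\mathbb{C}^*$. Let $S_m$ act birationally on $M=((\mathbb{C}^* )^n)^m$, viewed as the set of $m$-tuples of columns, by letting the transposition $(i,i+1)$ act as $PR^{(n)}_{i,i+1}$ on columns $i,i+1$ for $1\le i\le m-1$; and let $S_n$ act birationally on $M=((\mathbb{C}^* )^m)^n$, viewed as the set of $n$-tuples of rows, by letting the transposition $(j,j+1)$ act as $PR^{(m)}_{j,j+1}$ on rows $j,j+1$ for $1\le j\le n-1$. Then the actions of $S_n$ and $S_m$ on $M$ commute with each other.
   Context: For each integer $r\ge1$, $R^{(r)}$ is the rational map $((\mathbb{C}^* )^r)^2\to((\mathbb{C}^* )^r)^2$, $R^{(r)}(\mathbf{x},\mathbf{y})=(\mathbf{x}',\mathbf{y}')$, determined uniquely by $$x_1'\cdots x_k'=y_1\cdots y_k+\Delta_k(\mathbf{x},\mathbf{y})\,\eta(\mathbf{x},\mathbf{y})\quad(1\le k\le r),\qquad x_i'y_i'=x_iy_i\quad(1\le i\le r),$$ where $\Delta_1=1$, for $k\ge2$ $$\Delta_k(\mathbf{x},\mathbf{y})=x_1\cdots x_{k-1}+x_1\cdots x_{k-2}y_k+\dots+y_2\cdots y_k=\sum_{j=1}^k x_1\cdots x_{j-1}\,y_{j+1}\cdots y_k,$$ and $\eta(\mathbf{x},\mathbf{y})=\dfrac{x_1\cdots x_r-y_1\cdots y_r}{\Delta_r(\mathbf{x},\mathbf{y})}$.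 (In particular $\prod_i x_i'=\prod_i x_i$.) $R^{(r)}$ is a birational isomorphism which is involutive ($R^{21}R=1$, $R^{21}=PRP$) and satisfies the quantum Yang-Baxter equation; hence for every $N$ the group $S_N$ acts on $((\mathbb{C}^* )^r)^N$ by birational automorphisms, with $(i,i+1)$ acting by $PR^{(r)}_{i,i+1}$: apply $R^{(r)}$ to the $i$-th and $(i+1)$-st components, then interchange these two components ($P(\mathbf{x},\mathbf{y})=(\mathbf{y},\mathbf{x})$). Entries in a column are ordered by row index and entries in a row by column index. Commutation is an identity of birational automorphisms of $M$. *)

(* Defs.v *)
From mathcomp Require Import all_boot all_order all_algebra all_fingroup.
From mathcomp Require Import reals.
From mathcomp Require Import complex mpoly.

Set Implicit Arguments.
Unset Strict Implicit.
Unset Printing Implicit Defensive.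

Import GRing.Theory.
Local Open Scope ring_scope.

(* A rational map M --> M, for M = (C^* )^(n m), is represented by a total    *)
(* function on matrices whose values only matter on a nonempty Zariski open   *)
(* subset of M; two such functions are the same rational map when they agree  *)
(* on a nonempty Zariski open subset (any such subset is dense, M being       *)
(* irreducible).                                                              *)

Section RationalMaps.
Variables (C : fieldType) (n m : nat).
Implicit Types (X Y : 'M[C]_(n, m)) (f g : 'M[C]_(n, m) -> 'M[C]_(n, m)).

Definition torus X : Prop := forall i j, X i j != 0.

Definition meval_mx (p : {mpoly C[n * m]}) X : C := p.@[fun k => mxvec X 0 k].

(* The nonempty open subsets of M are those containing some nonempty basic    *)
(* open set {X in M | p(X) != 0}.                                             *)
Definition generically (P : 'M[C]_(n, m) -> Prop) : Prop :=
  exists2 p : {mpoly C[n * m]}, p != 0 &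
    forall X, torus X -> meval_mx p X != 0 -> P X.

Definition ratmap_eq f g : Prop := generically (fun X => f X = g X).

Definition rational_map f : Prop :=
  generically (fun X => torus (f X)) /\
  (forall i j, exists p q : {mpoly C[n * m]},
     generically (fun X =>
       meval_mx q X != 0 /\ f X i j = meval_mx p X / meval_mx q X)).

(* Preimages of nonempty open sets contain nonempty open sets; this is what   *)
(* makes composition with f on the right well defined on rational maps.       *)
Definition dominant f : Prop :=
  forall p : {mpoly C[n * m]}, p != 0 ->
    generically (fun X => meval_mx p (f X) != 0).

Definition birational f : Prop :=
  [/\ rational_map f, dominant f &
    exists g, [/\ rational_map g, dominant g,
                  ratmap_eq (f \o g) id & ratmap_eq (g \o f) id]].

(* The product s * t of 'S_N is "s, then t", i.e. the composite t o s of      *)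
(* permutations, so the last clause says that rho is a left action.           *)
Definition birational_action (N : nat)
    (rho : 'S_N -> 'M[C]_(n, m) -> 'M[C]_(n, m)) : Prop :=
  [/\ forall s, birational (rho s),
      ratmap_eq (rho 1%g) id &
      forall s t, ratmap_eq (rho (s * t)%g) (rho t \o rho s)].

End RationalMaps.

Section MapR.
Variables (C : fieldType) (r : nat).
Implicit Types x y : 'I_r -> C.

(* Indices start at 0: x_1 ... x_k is the product of the x i with i < k, and  *)
(* the summand x_1 ... x_(j-1) y_(j+1) ... y_k is indexed by j - 1.           *)
Definition prefix_prod x (k : nat) : C := \prod_(i < r | (i < k)%N) x i.

Definition Delta (k : nat) x y : C :=
  \sum_(j < r | (j < k)%N)
    (\prod_(i < r | (i < j)%N) x i) * (\prod_(i < r | (j < i < k)%N) y i).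

Definition eta x y : C := (prefix_prod x r - prefix_prod y r) / Delta r x y.

(* ratR x y x' y' means (x', y') = R^(r) (x, y).                              *)
Definition ratR x y x' y' : Prop :=
  (forall k : nat, (1 <= k <= r)%N ->
     prefix_prod x' k = prefix_prod y k + Delta k x y * eta x y) /\
  (forall i : 'I_r, x' i * y' i = x i * y i).

Lemma prefix_prodS x (i : 'I_r) : prefix_prod x i.+1 = x i * prefix_prod x i.
Proof.
rewrite /prefix_prod (bigD1 i) //=; congr (_ * _); apply: eq_bigl => j.
by rewrite ltnS andbC -ltn_neqAle.
Qed.

Lemma ratR_uniq x y x1 y1 x2 y2 :
  (forall i, x1 i != 0) -> (forall i, x2 i != 0) ->
  ratR x y x1 y1 -> ratR x y x2 y2 -> x1 =1 x2 /\ y1 =1 y2.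
Proof.
move=> nz1 nz2 [P1 Q1] [P2 Q2].
have eqP k : (k <= r)%N -> prefix_prod x1 k = prefix_prod x2 k.
  by case: k => [_|k le_k]; [rewrite /prefix_prod !big_pred0 | rewrite P1 ?P2].
have eqx : x1 =1 x2.
  move=> i; have := eqP _ (ltn_ord i); rewrite !prefix_prodS -eqP 1?ltnW //.
  by apply: mulIf; apply/prodf_neq0 => j _.
by split=> // i; apply: (mulfI (nz1 i)); rewrite Q1 {1}eqx Q2.
Qed.

End MapR.

Section Generators.
Variables (C : fieldType) (n m : nat).
Implicit Types X Y : 'M[C]_(n, m).

(* Y is the image of X under P R applied to the columns i, i' (resp. the rows *)
(* j, j'): R sends the pair (X_i, X_i') to (Y_i', Y_i), in this order because *)
(* of P.                                                                      *)
Definition PR_cols (i i' : 'I_m) X Y : Prop :=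
  ratR (fun k => X k i) (fun k => X k i') (fun k => Y k i') (fun k => Y k i) /\
  (forall l, l != i -> l != i' -> forall k, Y k l = X k l).

Definition PR_rows (j j' : 'I_n) X Y : Prop :=
  ratR (fun k => X j k) (fun k => X j' k) (fun k => Y j' k) (fun k => Y j k) /\
  (forall l, l != j -> l != j' -> forall k, Y l k = X l k).

Definition column_action (rho : 'S_m -> 'M[C]_(n, m) -> 'M[C]_(n, m)) : Prop :=
  birational_action rho /\
  (forall i i' : 'I_m, i' = i.+1 :> nat ->
     generically (fun X => PR_cols i i' X (rho (tperm i i') X))).

Definition row_action (sigma : 'S_n -> 'M[C]_(n, m) -> 'M[C]_(n, m)) : Prop :=
  birational_action sigma /\
  (forall j j' : 'I_n, j' = j.+1 :> nat ->
     generically (fun X => PR_rows j j' X (sigma (tperm j j') X))).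

End Generators.

(* Main.v *)
Require Import Defs.
From mathcomp Require Import all_boot all_order all_algebra all_fingroup.
From mathcomp Require Import reals complex.
From mathcomp Require Import mpoly ring.

Set Implicit Arguments.
Unset Strict Implicit.
Unset Printing Implicit Defensive.

Import GRing.Theory.
Local Open Scope ring_scope.

(** The move P R on a pair of lines (x, y), each with r entries, is governed by
    a cyclic sequence u, the carrier, solution of
      x_k u_k - y_k u_(k-1) = 1   (k modulo r),
    which is unique as soon as the products of x and y differ.  In terms of u
    the map R is a mere gauge transformation:
      x'_k = x_k u_k / u_(k-1)   and   y'_k = y_k u_(k-1) / u_k
    ([ratR_carrier], [carrier_uniq]).

    Apply a column move, with carrier u, to columns i, i+1 and look at the
    system defining the carrier v of rows j, j+1.  Only its equations i and
    i+1 change, and eliminating v_i from them gives the same relation between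
    v_(i-1) and v_(i+1) as before.  Hence the new row carrier differs from v at
    index i alone ([row_carrier_after_columns]); symmetrically, a row move
    alters the column carrier at index j alone.  So the two orders of
    composition agree outside of the 2 x 2 block where the two pairs of lines
    meet, and all four entries of the block agree by virtue of a single identity
    between the old and the new values of u_j and v_i ([block_exchange]).  This
    gives the commutation of the generators ([moves_commute]).

    All of this holds at the points where the matrices involved have nonzero
    entries and where the functions eta in use do not vanish.  These conditions
    are generic: eta is nonzero where a nonzero polynomial is, and dominance
    transports a generic condition through a rational map.  Finally adjacent
    transpositions generate the symmetric groups, and commutation with a fixed
    birational map passes to products ([action_commute]). *)

(** * The carrier of a pair of lines *)

Section Carrier.
Variables (C : fieldType) (r : nat).
Implicit Types x y u v : 'I_r -> C.

Lemma ord_pred_succ (k k' : 'I_r) : k' = k.+1 :> nat -> ord_pred k' = k.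
Proof.
by move=> e; apply: val_inj; rewrite /= e addSn /= modnDr modn_small.
Qed.

Lemma ord_pred_first (k : 'I_r) : k = 0%N :> nat -> (ord_pred k).+1 = r.
Proof.
move=> e; rewrite /= e add0n modn_small prednK //.
all: by apply: leq_trans (ltn_ord k).
Qed.

(** Here [ord_pred] is the cyclic predecessor, so that the last value of u
    feeds the first equation. *)
Definition carrier x y u : Prop :=
  forall k, x k * u k - y k * u (ord_pred k) = 1.

Lemma prefix_prod0 x : prefix_prod x 0 = 1.
Proof. by rewrite /prefix_prod big_pred0. Qed.

Lemma prefix_prod_neq0 x k : (forall i, x i != 0) -> prefix_prod x k != 0.
Proof. by move=> nzx; apply/prodf_neq0 => i _. Qed.

Lemma Delta0 x y : Delta 0 x y = 0.
Proof. by rewrite /Delta big_pred0. Qed.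

Lemma DeltaS x y (k : 'I_r) :
  Delta k.+1 x y = y k * Delta k x y + prefix_prod x k.
Proof.
rewrite /Delta (bigD1 k) //= addrC; congr (_ + _); last first.
  rewrite [X in _ * X]big_pred0 ?mulr1 // => i.
  by rewrite ltnS; case: ltngtP.
rewrite big_distrr /=; apply: eq_big => [j | j].
  by rewrite ltnS andbC -ltn_neqAle.
rewrite ltnS andbC -ltn_neqAle => lt_jk.
rewrite [RHS]mulrCA; congr (_ * _).
rewrite (bigD1 k) /= ?lt_jk ?ltnS ?leqnn //=.
congr (_ * _); apply: eq_bigl => i.
rewrite ltnS -andbA; congr (_ && _).
by rewrite andbC -ltn_neqAle.
Qed.

(** The difference d of two carriers satisfies x_k d_k = y_k d_(k-1).  Going
    once around the cycle gives (prod x) d = (prod y) d for its last value,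
    which thus vanishes, and then so do all the other ones. *)
Lemma carrier_uniq x y u v :
  (forall k, x k != 0) -> prefix_prod x r != prefix_prod y r ->
  carrier x y u -> carrier x y v -> u =1 v.
Proof.
move=> nzx neq_xy cu cv.
have dE k : x k * (u k - v k) = y k * (u (ord_pred k) - v (ord_pred k)).
  apply/eqP; rewrite -subr_eq0; apply/eqP.
  transitivity ((x k * u k - y k * u (ord_pred k))
                - (x k * v k - y k * v (ord_pred k))); first by ring.
  by rewrite cu cv subrr.
move=> k; have r_gt0 : (0 < r)%N by apply: leq_ltn_trans (ltn_ord k).
have lt_last : (r.-1 < r)%N by rewrite prednK.
pose l := Ordinal lt_last.
have dP : forall j : 'I_r, prefix_prod x j.+1 * (u j - v j)
                           = prefix_prod y j.+1 * (u l - v l).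
  case=> j; elim: j => [|j IHj] lt_j.
    have := dE (Ordinal lt_j).
    have -> : ord_pred (Ordinal lt_j) = l.
      by apply: val_inj; apply: succn_inj; rewrite ord_pred_first //= prednK.
    by rewrite !(prefix_prodS _ (Ordinal lt_j)) /= !prefix_prod0 !mulr1.
  have /= := dE (Ordinal lt_j).
  rewrite (@ord_pred_succ (Ordinal (ltnW lt_j))) // => dj.
  rewrite !(prefix_prodS _ (Ordinal lt_j)) /= mulrAC dj -!mulrA; congr (_ * _).
  by rewrite mulrC IHj.
have := dP l; rewrite /= prednK // => /eqP.
rewrite -subr_eq0 -mulrBl mulf_eq0 subr_eq0 (negPf neq_xy) /= => /eqP dl0.
have /eqP := dP k; rewrite dl0 mulr0 mulf_eq0 (negPf (prefix_prod_neq0 _ nzx)).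
by rewrite subr_eq0 => /eqP.
Qed.

Lemma eta_neq0_prod x y : eta x y != 0 -> prefix_prod x r != prefix_prod y r.
Proof. by rewrite /eta mulf_eq0 subr_eq0; case/norP. Qed.

(** Write X_k and X'_k for the prefix products of x and x'.  The recursion for
    Delta turns the definition of R into X'_(k+1) = y_k X'_k + eta X_k, and
    division by eta X_k shows that u_k = X'_(k+1) / (eta X_(k+1)) is a carrier.
    It closes up cyclically because X'_r = X_r. *)
Lemma ratR_carrier x y x' y' :
  (forall k, x k != 0) -> (forall k, x' k != 0) -> eta x y != 0 ->
  ratR x y x' y' ->
  exists u, [/\ forall k, u k != 0, carrier x y u,
                forall k, x' k = x k * u k / u (ord_pred k) &
                forall k, y' k = y k * u (ord_pred k) / u k].
Proof.
move=> nzx nzx' nz_eta [prefE prodE].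
have nzX k : prefix_prod x k != 0 by apply: prefix_prod_neq0.
have nzX' k : prefix_prod x' k != 0 by apply: prefix_prod_neq0.
have prefE0 k : (k <= r)%N ->
    prefix_prod x' k = prefix_prod y k + Delta k x y * eta x y.
  case: k => [_|k le_kr]; first by rewrite !prefix_prod0 Delta0 mul0r addr0.
  exact: prefE.
have prefS (k : 'I_r) : prefix_prod x' k.+1
    = y k * prefix_prod x' k + prefix_prod x k * eta x y.
  by rewrite !prefE0 ?(ltnW (ltn_ord k)) // DeltaS prefix_prodS; ring.
have prefr : prefix_prod x' r = prefix_prod x r.
  have nzD : Delta r x y != 0.
    by move: nz_eta; rewrite /eta mulf_eq0 invr_eq0; case/norP.
  by rewrite prefE0 // /eta [Delta r x y * _]mulrC (divfK nzD) addrC subrK.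
(* u_k is w (k+1); the shift makes the boundary value w 0 = w r available *)
pose w k := prefix_prod x' k / (eta x y * prefix_prod x k).
have nzw k : w k != 0 by rewrite mulf_neq0 // invr_eq0 mulf_neq0.
have w_pred (k : 'I_r) : w (ord_pred k).+1 = w k.
  case: (posnP k) => [k0 | k_gt0].
    rewrite ord_pred_first // k0 /w prefr !prefix_prod0; field.
    by rewrite nz_eta nzX.
  have lt_k : (k.-1 < r)%N by rewrite prednK // ltnW.
  by rewrite (@ord_pred_succ (Ordinal lt_k)) /= prednK.
have x'E (k : 'I_r) : x' k = x k * w k.+1 / w k.
  rewrite /w !prefix_prodS; field.
  by rewrite nz_eta nzX nzX' nzx.
exists (fun k => w k.+1); split=> // k; rewrite ?w_pred //.
  rewrite /w prefS prefix_prodS; field.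
  by rewrite nz_eta nzX nzx.
apply: (mulfI (nzx' k)); rewrite prodE x'E; field.
by rewrite !nzw.
Qed.

End Carrier.

(** * The block where two columns and two rows meet *)

(** Throughout, (a b; c d) is the block, u0, u1, u2 are the values of the column
    carrier at j-1, j, j+1 and v0, v1, v2 those of the row carrier at i-1, i,
    i+1.  The column move replaces the block by
      (b u0/u1, a u1/u0; d u1/u2, c u2/u1),
    the row move by (c v0/v1, d v1/v2; a v1/v0, b v2/v1). *)

Section Block.
Variable C : fieldType.

(** After the column move, v0 and v2 are still joined by some middle value v1'.
    Solving the first equation for v1' and putting it into the second leaves
    the conservation law that a + d is the sum of the two new entries in these
    positions. *)
Lemma block_carrier (a b c d u0 u1 u2 v0 v1 v2 : C) :
  b != 0 -> u0 != 0 -> u1 != 0 -> u2 != 0 ->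
  a * u1 - b * u0 = 1 -> c * u2 - d * u1 = 1 ->
  a * v1 - c * v0 = 1 -> b * v2 - d * v1 = 1 ->
  exists v1', b * u0 / u1 * v1' - d * u1 / u2 * v0 = 1
           /\ a * u1 / u0 * v2 - c * u2 / u1 * v1' = 1.
Proof.
move=> nzb nz0 nz1 nz2 e1 e2 e3 e4.
exists (u1 * (u2 + d * u1 * v0) / (b * u0 * u2)).
split; first by field; rewrite nz1 nz0 nzb nz2.
(* once multiplied by b * u0, the second equation is e5 *)
have e2' : c * u2 = 1 + d * u1 by rewrite -e2 subrK.
have e3' : c * v0 = a * v1 - 1 by rewrite -e3 opprB addrC subrK.
have e4' : b * v2 = 1 + d * v1 by rewrite -e4 subrK.
have e5 : a * u1 * (b * v2) - (c * u2 + d * u1 * (c * v0)) = b * u0.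
  rewrite e2' e3' e4'; transitivity (a * u1 - 1); first by ring.
  by rewrite -e1 opprB addrC subrK.
apply: (mulfI (mulf_neq0 nzb nz0)); rewrite mulr1 -[RHS]e5; field.
by rewrite nz0 nz1 nz2 nzb.
Qed.

(** The equations for v1' and u1', cleared of denominators, are e5 and e6 below.
    With their help the claim, multiplied by b c, reduces to
    b (v2 + d v1 u0) = c (u2 + d u1 v0), which is a consequence of the four
    original carrier equations. *)
Lemma block_exchange (a b c d u0 u1 u2 v0 v1 v2 u1' v1' : C) :
  b != 0 -> c != 0 -> u1 != 0 -> u2 != 0 -> v1 != 0 -> v2 != 0 ->
  a * u1 - b * u0 = 1 -> c * u2 - d * u1 = 1 ->
  a * v1 - c * v0 = 1 -> b * v2 - d * v1 = 1 ->
  b * u0 / u1 * v1' - d * u1 / u2 * v0 = 1 ->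
  c * v0 / v1 * u1' - d * v1 / v2 * u0 = 1 ->
  u1 * u1' * (v0 * v2) = v1 * v1' * (u0 * u2).
Proof.
move=> nzb nzc nz1 nz2 nzv1 nzv2 e1 e2 e3 e4 e5 e6.
have {}e5 : b * u0 * u2 * v1' = u1 * (u2 + d * u1 * v0).
  apply/eqP; rewrite -subr_eq0; apply/eqP.
  transitivity (u1 * u2 * (b * u0 / u1 * v1' - d * u1 / u2 * v0 - 1)).
    by field; rewrite nz1 nz2.
  by rewrite e5 subrr mulr0.
have {}e6 : c * v0 * v2 * u1' = v1 * (v2 + d * v1 * u0).
  apply/eqP; rewrite -subr_eq0; apply/eqP.
  transitivity (v1 * v2 * (c * v0 / v1 * u1' - d * v1 / v2 * u0 - 1)).
    by field; rewrite nzv1 nzv2.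
  by rewrite e6 subrr mulr0.
apply: (mulfI (mulf_neq0 nzb nzc)).
transitivity (b * u1 * (c * v0 * v2 * u1')); first by ring.
transitivity (c * v1 * (b * u0 * u2 * v1')); last by ring.
rewrite e5 e6; apply/eqP; rewrite -subr_eq0; apply/eqP.
transitivity (u1 * v1 * ((b * v2 - d * v1) - (c * u2 - d * u1)
  + d * v1 * (1 - (a * u1 - b * u0)) - d * u1 * (1 - (a * v1 - c * v0)))).
  by ring.
by rewrite e1 e2 e3 e4; ring.
Qed.

End Block.

(** * Commutation of a column move and a row move *)

Section Moves.
Variable C : fieldType.

(** [Y] is the image of [X] under P R on columns [i], [i'], with carrier [u];
    row moves are expressed by transposing the matrices. *)
Definition column_move n m (i i' : 'I_m) (u : 'I_n -> C) (X Y : 'M[C]_(n, m)) :=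
  [/\ forall k, u k != 0,
      carrier (fun k => X k i) (fun k => X k i') u,
      forall k, Y k i' = X k i * u k / u (ord_pred k),
      forall k, Y k i = X k i' * u (ord_pred k) / u k &
      forall l, l != i -> l != i' -> forall k, Y k l = X k l].

Lemma PR_colsP n m (i i' : 'I_m) (X Y : 'M[C]_(n, m)) :
  torus X -> torus Y -> eta (fun k => X k i) (fun k => X k i') != 0 ->
  PR_cols i i' X Y -> exists u, column_move i i' u X Y.
Proof.
move=> tX tY nz_eta [RXY fixXY].
have [u [nzu cu Ei' Ei]] :=
  ratR_carrier (fun k => tX k i) (fun k => tY k i') nz_eta RXY.
by exists u.
Qed.

Lemma PR_rowsP n m (j j' : 'I_n) (X Y : 'M[C]_(n, m)) :
  torus X -> torus Y -> eta (fun k => X j k) (fun k => X j' k) != 0 ->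
  PR_rows j j' X Y -> exists v, column_move j j' v X^T Y^T.
Proof.
move=> tX tY nz_eta [RXY fixXY].
have [v [nzv cv Ei' Ei]] := ratR_carrier (tX j) (tY j') nz_eta RXY.
exists v; split=> [|k|k|k|l lj lj' k] //; rewrite !mxE //; exact: fixXY.
Qed.

Lemma ord_pred_inj r : injective (@ord_pred r).
Proof. exact: can_inj (@ord_predK r). Qed.

(** The entries of columns other than [i] and [i'] = [i] + 1 are fixed, so the
    old row carrier still solves their equations; its value at [i] occurs only
    in the equations [i] and [i'], where [block_carrier] repairs it. *)
Lemma row_carrier_after_columns n m (i i' : 'I_m) (j j' : 'I_n) u v
    (X Y : 'M[C]_(n, m)) :
  i' = i.+1 :> nat -> j' = j.+1 :> nat -> torus X ->
  column_move i i' u X Y ->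
  carrier (fun l => X j l) (fun l => X j' l) v ->
  exists2 v', carrier (fun l => Y j l) (fun l => Y j' l) v' &
              forall l, l != i -> v' l = v l.
Proof.
move=> ii' jj' tX [nzu cu Ei' Ei Eo] cv.
have pi' := ord_pred_succ ii'; have pj' := ord_pred_succ jj'.
have ni'i : i' != i by rewrite -val_eqE /= ii' gtn_eqF.
have npi : ord_pred i != i.
  by apply: contraNneq ni'i => pi; rewrite -(inj_eq (@ord_pred_inj m)) pi' pi.
have cuj := cu j; have cuj' := cu j'; have cvi := cv i; have cvi' := cv i'.
rewrite pj' in cuj'; rewrite pi' in cvi'.
have [w [e1 e2]] := block_carrier (tX j i') (nzu _) (nzu j) (nzu j')
                                  cuj cuj' cvi cvi'.
exists (fun l => if l == i then w else v l) => [l | l /negPf-> //].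
case: (eqVneq l i) => [-> | nli].
  by rewrite (negPf npi) !Ei pj' e1.
case: (eqVneq l i') => [-> | nli'].
  by rewrite pi' eqxx !Ei' pj' e2.
have /negPf-> : ord_pred l != i by rewrite -pi' (inj_eq (@ord_pred_inj m)).
by rewrite !Eo // cv.
Qed.

(** By uniqueness the carriers u' and v' of the second moves coincide with u and
    v except at [j] and [i].  On the 2 x 2 block the exchange identity,
    solved for v' at [i], makes each of the four entries a field identity;
    elsewhere both sides are the same expression. *)
Lemma moves_commute n m (i i' : 'I_m) (j j' : 'I_n) u v u' v'
    (X Y Z W1 W2 : 'M[C]_(n, m)) :
  i' = i.+1 :> nat -> j' = j.+1 :> nat -> torus X -> torus Y -> torus Z ->
  eta (fun l => Y j l) (fun l => Y j' l) != 0 ->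
  eta (fun k => Z k i) (fun k => Z k i') != 0 ->
  column_move i i' u X Y -> column_move j j' v' Y^T W1^T ->
  column_move j j' v X^T Z^T -> column_move i i' u' Z W2 ->
  W1 = W2.
Proof.
move=> ii' jj' tX tY tZ nz_etaY nz_etaZ mXY mYW mXZ mZW.
have pi' := ord_pred_succ ii'; have pj' := ord_pred_succ jj'.
have ni'i : i' != i by rewrite -val_eqE /= ii' gtn_eqF.
have nj'j : j' != j by rewrite -val_eqE /= jj' gtn_eqF.
have npi l : l != i' -> ord_pred l != i.
  by rewrite -pi' (inj_eq (@ord_pred_inj m)).
have npj k : k != j' -> ord_pred k != j.
  by rewrite -pj' (inj_eq (@ord_pred_inj n)).
have nii' : i != i' by rewrite eq_sym.
have njj' : j != j' by rewrite eq_sym.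
have [nzu cu Yi' Yi Yo] := mXY; have [nzu' cu' Wi' Wi Wo] := mZW.
have [nzv cv Zj' Zj Zo] := mXZ; have [nzv' cv' Wj' Wj Wo'] := mYW.
have {cv}cv : carrier (fun l => X j l) (fun l => X j' l) v.
  by move=> l; rewrite -(cv l) !mxE.
have {cv'}cv' : carrier (fun l => Y j l) (fun l => Y j' l) v'.
  by move=> l; rewrite -(cv' l) !mxE.
have {Zj}Zj k : Z j k = X j' k * v (ord_pred k) / v k.
  by have := Zj k; rewrite !mxE.
have {Zj'}Zj' k : Z j' k = X j k * v k / v (ord_pred k).
  by have := Zj' k; rewrite !mxE.
have {Wj}Wj k : W1 j k = Y j' k * v' (ord_pred k) / v' k.
  by have := Wj k; rewrite !mxE.
have {Wj'}Wj' k : W1 j' k = Y j k * v' k / v' (ord_pred k).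
  by have := Wj' k; rewrite !mxE.
have {Zo}Zo k : k != j -> k != j' -> forall l, Z k l = X k l.
  by move=> kj kj' l; have := Zo k kj kj' l; rewrite !mxE.
have {Wo'}Wo' k : k != j -> k != j' -> forall l, W1 k l = Y k l.
  by move=> kj kj' l; have := Wo' k kj kj' l; rewrite !mxE.
have v'E l : l != i -> v' l = v l.
  move=> li; have [v1 cv1 /(_ l li) <-] :=
    row_carrier_after_columns ii' jj' tX mXY cv.
  exact: (carrier_uniq (tY j) (eta_neq0_prod nz_etaY) cv' cv1).
have u'E k : k != j -> u' k = u k.
  have tXT : torus X^T by move=> a b; rewrite mxE.
  have cuT : carrier (fun k => X^T i k) (fun k => X^T i' k) u.
    by move=> h; rewrite !mxE.
  move=> kj; have [u1 cu1 /(_ k kj) <-] :=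
    row_carrier_after_columns jj' ii' tXT mXZ cuT.
  have {}cu1 : carrier (fun k => Z k i) (fun k => Z k i') u1.
    by move=> h; rewrite -[RHS](cu1 h) !mxE.
  exact: (carrier_uniq (fun k => tZ k i) (eta_neq0_prod nz_etaZ) cu' cu1).
have exch : u j * u' j * (v (ord_pred i) * v i')
          = v i * v' i * (u (ord_pred j) * u j').
  have cuj := cu j; have cuj' := cu j'; have cvi := cv i; have cvi' := cv i'.
  rewrite pj' in cuj'; rewrite pi' in cvi'.
  have cu'j := cu' j; have cv'i := cv' i.
  rewrite !Zj pi' (u'E _ (npj _ njj')) in cu'j.
  rewrite !Yi pj' (v'E _ (npi _ nii')) in cv'i.
  exact: (block_exchange (tX j i') (tX j' i) (nzu j) (nzu j') (nzv i) (nzv i')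
            cuj cuj' cvi cvi' cv'i cu'j).
have v'iE : v' i = u j * u' j * (v (ord_pred i) * v i')
                   / (v i * (u (ord_pred j) * u j')).
  rewrite exch; field.
  by rewrite !nzu nzv.
have v'pi := v'E _ (npi _ nii'); have v'i' := v'E _ ni'i.
have u'pj := u'E _ (npj _ njj'); have u'j' := u'E _ nj'j.
have nz := (nzu, nzu', nzv).
apply/matrixP => k l.
have [->|nli] := eqVneq l i; [|have [->|nli'] := eqVneq l i'].
- have [->|nkj] := eqVneq k j; [|have [->|nkj'] := eqVneq k j'].
  + by rewrite Wj Wi Yi Zj v'pi u'pj pi' pj' v'iE; field; rewrite !nz.
  + by rewrite Wj' Wi Yi Zj' v'pi u'j' pi' pj' v'iE; field; rewrite !nz.
  + by rewrite Wo' // Wi Yi Zo // !u'E ?npj.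
- have [->|nkj] := eqVneq k j; [|have [->|nkj'] := eqVneq k j'].
  + by rewrite Wj Wi' Yi' Zj v'i' u'pj pi' pj' v'iE; field; rewrite !nz.
  + by rewrite Wj' Wi' Yi' Zj' v'i' u'j' pi' pj' v'iE; field; rewrite !nz.
  + by rewrite Wo' // Wi' Yi' Zo // !u'E ?npj.
- have [->|nkj] := eqVneq k j; [|have [->|nkj'] := eqVneq k j'].
  + by rewrite Wj Wo // Yo // Zj !v'E ?npi.
  + by rewrite Wj' Wo // Yo // Zj' !v'E ?npi.
  + by rewrite Wo' // Wo // Yo // Zo.
Qed.

End Moves.

(** * Generic conditions *)

Section Genericity.
Variables (C : fieldType) (n m : nat).
Implicit Types (X Y : 'M[C]_(n, m)) (f g h : 'M[C]_(n, m) -> 'M[C]_(n, m)).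

Lemma generically_and (P Q : 'M[C]_(n, m) -> Prop) :
  generically P -> generically Q -> generically (fun X => P X /\ Q X).
Proof.
move=> [p nzp pP] [q nzq qQ]; exists (p * q); first by rewrite mulf_neq0.
move=> X tX; rewrite /meval_mx mevalM mulf_eq0 => /norP[nzpX nzqX].
by split; [apply: pP | apply: qQ].
Qed.

Lemma generically_imp (P Q : 'M[C]_(n, m) -> Prop) :
  (forall X, torus X -> P X -> Q X) -> generically P -> generically Q.
Proof. by move=> PQ [p nzp pP]; exists p => // X tX nzpX; apply/PQ/pP. Qed.

Lemma generically_comp f (P : 'M[C]_(n, m) -> Prop) :
  rational_map f -> dominant f -> generically P ->
  generically (fun X => P (f X)).
Proof.
move=> [tor_f _] dom_f [p nzp pP].
apply: generically_imp (generically_and tor_f (dom_f p nzp)) => X _ [].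
exact: pP.
Qed.

Definition polynomial_fun (F : 'M[C]_(n, m) -> C) : Prop :=
  exists p, forall X, meval_mx p X = F X.

Lemma polynomial_entry i j : polynomial_fun (fun X => X i j).
Proof.
by exists ('X_(mxvec_index i j)) => X; rewrite /meval_mx mevalXU mxvecE.
Qed.

Lemma polynomial_sub F G : polynomial_fun F -> polynomial_fun G ->
  polynomial_fun (fun X => F X - G X).
Proof.
move=> [p pF] [q qG]; exists (p - q) => X.
by rewrite /meval_mx mevalB -pF -qG.
Qed.

Lemma polynomial_mul F G : polynomial_fun F -> polynomial_fun G ->
  polynomial_fun (fun X => F X * G X).
Proof.
move=> [p pF] [q qG]; exists (p * q) => X.
by rewrite /meval_mx mevalM -pF -qG.
Qed.

Lemma polynomial_prod r (P : pred 'I_r) (F : 'I_r -> 'M[C]_(n, m) -> C) :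
  (forall k, polynomial_fun (F k)) ->
  polynomial_fun (fun X => \prod_(k | P k) F k X).
Proof.
move=> polF.
elim: (index_enum _) => [|k s [p IHs]].
  by exists 1 => X; rewrite /meval_mx meval1 big_nil.
case Pk: (P k); last by exists p => X; rewrite IHs big_cons Pk.
have [q qF] := polF k; exists (q * p) => X.
by rewrite big_cons Pk -IHs -qF /meval_mx mevalM.
Qed.

Lemma polynomial_sum r (P : pred 'I_r) (F : 'I_r -> 'M[C]_(n, m) -> C) :
  (forall k, polynomial_fun (F k)) ->
  polynomial_fun (fun X => \sum_(k | P k) F k X).
Proof.
move=> polF.
elim: (index_enum _) => [|k s [p IHs]].
  by exists 0 => X; rewrite /meval_mx meval0 big_nil.
case Pk: (P k); last by exists p => X; rewrite IHs big_cons Pk.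
have [q qF] := polF k; exists (q + p) => X.
by rewrite big_cons Pk -IHs -qF /meval_mx mevalD.
Qed.

Lemma polynomial_neq0_generic F X0 :
  polynomial_fun F -> F X0 != 0 -> generically (fun X => F X != 0).
Proof.
move=> [p pF] nzF0; exists p => [|X _]; last by rewrite pF.
by apply: contraNneq nzF0 => p0; rewrite -pF p0 /meval_mx meval0.
Qed.

(** The maps [e] and [f] select two disjoint families of entries, such as two
    rows or two columns.  At the matrix with ones on [e] and zeros elsewhere,
    the two products are 1 and 0 and Delta reduces to the single summand
    x_1 ... x_(r-1) = 1; hence (prod x - prod y) Delta is a nonzero polynomial,
    and eta vanishes only where it does. *)
Lemma eta_neq0_generic r (e f : 'I_r -> 'I_n * 'I_m) :
  (0 < r)%N -> (forall k l, e k != f l) ->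
  generically (fun X => eta (fun k => X (e k).1 (e k).2)
                            (fun k => X (f k).1 (f k).2) != 0).
Proof.
move=> r_gt0 ef_disj.
pose x (e : 'I_r -> 'I_n * 'I_m) X k := X (e k).1 (e k).2.
pose F X := (prefix_prod (x e X) r - prefix_prod (x f X) r)
            * Delta r (x e X) (x f X).
pose X0 : 'M[C]_(n, m) := \matrix_(i, j) ((i, j) \in codom e)%:R.
have xe k : x e X0 k = 1 by rewrite /x mxE -surjective_pairing codom_f.
have xf k : x f X0 k = 0.
  rewrite /x mxE -surjective_pairing; case: codomP => [[l fl]|//].
  by have := ef_disj l k; rewrite fl eqxx.
have polF : polynomial_fun F.
  apply: polynomial_mul.
    apply: polynomial_sub; apply: polynomial_prod => k;
      exact: polynomial_entry.
  apply: polynomial_sum => k; apply: polynomial_mul.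
    by apply: polynomial_prod => l; apply: polynomial_entry.
  by apply: polynomial_prod => l; apply: polynomial_entry.
have lt_last : (r.-1 < r)%N by rewrite prednK.
have FX0 : F X0 != 0.
  rewrite /F -[X in Delta X](prednK r_gt0) (DeltaS _ _ (Ordinal lt_last)).
  rewrite xf mul0r add0r [X in _ - X](_ : _ = 0) ?subr0.
    by rewrite mulf_neq0 // prefix_prod_neq0 // => k; rewrite xe oner_neq0.
  rewrite -[X in prefix_prod _ X](prednK r_gt0).
  by rewrite (prefix_prodS _ (Ordinal lt_last)) xf mul0r.
apply: generically_imp (polynomial_neq0_generic polF FX0) => X _.
by rewrite /F /eta !mulf_eq0 invr_eq0.
Qed.

Definition ratmap_commute f g := ratmap_eq (f \o g) (g \o f).

Lemma ratmap_commute_sym f g : ratmap_commute f g -> ratmap_commute g f.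
Proof. by apply: generically_imp => X _ ->. Qed.

End Genericity.

(** * From generators to group actions *)

(** For k = j - 1, the transposition (i j) is the conjugate of (i k) by the
    adjacent transposition (k j); induct on j - i. *)
Lemma adjacent_tperm_ind N (P : 'S_N -> Prop) :
  P 1%g -> (forall s t, P s -> P t -> P (s * t)%g) ->
  (forall i i' : 'I_N, i' = i.+1 :> nat -> P (tperm i i')) ->
  forall s, P s.
Proof.
move=> P1 PM Padj.
have Plt d : forall i j : 'I_N, j = (i + d.+1)%N :> nat -> P (tperm i j).
  elim: d => [|d IHd] i j ej; first by apply: Padj; rewrite ej addn1.
  have lt_k : (i + d.+1 < N)%N.
    by apply: ltn_trans (ltn_ord j); rewrite ej ltn_add2l.
  pose k := Ordinal lt_k.
  have jk : j = k.+1 :> nat by rewrite ej addnS.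
  have neq_ij : i != j by rewrite -val_eqE /= ej -[X in X != _]addn0 eqn_add2l.
  have neq_ik : i != k by rewrite -val_eqE /= -[X in X != _]addn0 eqn_add2l.
  have -> : tperm i j = (tperm k j * tperm i k * tperm k j)%g.
    rewrite -{1}[tperm k j]tpermV -mulgA.
    rewrite -[(_ * (_ * _))%g]/(tperm i k ^ tperm k j)%g.
    by rewrite tpermJ tpermL tpermD // eq_sym.
  by apply: (PM); [apply: (PM)|]; first [exact: Padj | exact: IHd].
have Ptperm i j : P (tperm i j).
  case: (ltngtP i j) => [lt|lt|/val_inj->]; last by rewrite tperm1.
    by apply: (Plt (j - i.+1)%N); rewrite -addSnnS subnKC.
  by rewrite tpermC; apply: (Plt (i - j.+1)%N); rewrite -addSnnS subnKC.
move=> s; have [ts -> _] := prod_tpermP s.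
by elim: ts => [|t ts IHts]; rewrite ?big_nil // big_cons; apply: PM.
Qed.

(** Equality of rational maps is preserved under composition on the right only
    with a dominant map; this is where birationality of [g] and of the [rho s]
    comes in. *)
Lemma action_commute (C : fieldType) n m N
    (rho : 'S_N -> 'M[C]_(n, m) -> 'M[C]_(n, m)) g :
  birational_action rho -> birational g ->
  (forall i i' : 'I_N, i' = i.+1 :> nat ->
     ratmap_commute g (rho (tperm i i'))) ->
  forall s, ratmap_commute g (rho s).
Proof.
move=> [bir rho1 rhoM] [rat_g dom_g _].
apply: adjacent_tperm_ind => [|s t cs ct].
  have e1 := generically_comp rat_g dom_g rho1.
  by apply: generically_imp (generically_and rho1 e1) => X _ /= [-> ->].
have [rat_s dom_s _] := bir s.
have e1 := generically_comp rat_s dom_s ct.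
have e2 := generically_comp rat_g dom_g (rhoM s t).
apply: generically_imp (generically_and (generically_and (rhoM s t) cs)
                                        (generically_and e1 e2)) => X _ /=.
by move=> [[-> cX] [-> ->]] /=; rewrite -cX.
Qed.

(** With f and g the column move and the row move, the four moves X -> f X,
    X -> g X, f X -> g (f X) and g X -> f (g X) must all be nondegenerate; the
    conditions for the last two are those for the second and the first, pulled
    back along f and g. *)
Lemma generators_commute (C : fieldType) n m
    (rho : 'S_m -> 'M[C]_(n, m) -> 'M[C]_(n, m))
    (sigma : 'S_n -> 'M[C]_(n, m) -> 'M[C]_(n, m))
    (i i' : 'I_m) (j j' : 'I_n) :
  column_action rho -> row_action sigma ->
  i' = i.+1 :> nat -> j' = j.+1 :> nat ->
  ratmap_commute (sigma (tperm j j')) (rho (tperm i i')).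
Proof.
move=> [[bir_rho _ _] genR] [[bir_sig _ _] genS] ii' jj'.
have nii' : i != i' by rewrite -val_eqE /= ii' ltn_eqF.
have njj' : j != j' by rewrite -val_eqE /= jj' ltn_eqF.
have [rat_r dom_r _] := bir_rho (tperm i i').
have [rat_s dom_s _] := bir_sig (tperm j j').
set f := rho _ in rat_r dom_r *; set g := sigma _ in rat_s dom_s *.
have tor_f := rat_r.1; have tor_g := rat_s.1.
have eta_c : generically (fun X : 'M[C]_(n, m) =>
    eta (fun k => X k i) (fun k => X k i') != 0).
  apply: (@eta_neq0_generic C n m n (fun k => (k, i)) (fun k => (k, i'))).
    exact: leq_ltn_trans (ltn_ord j).
  by move=> k l; rewrite xpair_eqE (negPf nii') andbF.
have eta_r : generically (fun X : 'M[C]_(n, m) =>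
    eta (fun l => X j l) (fun l => X j' l) != 0).
  apply: (@eta_neq0_generic C n m m (fun l => (j, l)) (fun l => (j', l))).
    exact: leq_ltn_trans (ltn_ord i).
  by move=> k l; rewrite xpair_eqE (negPf njj').
have good_c : generically (fun X => [/\ torus (f X),
    eta (fun k => X k i) (fun k => X k i') != 0 & PR_cols i i' X (f X)]).
  apply: generically_imp (generically_and tor_f
                            (generically_and eta_c (genR i i' ii'))).
  by move=> X _ [? []].
have good_r : generically (fun X => [/\ torus (g X),
    eta (fun l => X j l) (fun l => X j' l) != 0 & PR_rows j j' X (g X)]).
  apply: generically_imp (generically_and tor_g
                            (generically_and eta_r (genS j j' jj'))).
  by move=> X _ [? []].
have good_rf := generically_comp rat_r dom_r good_r.
have good_cg := generically_comp rat_s dom_s good_c.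
apply: generically_imp (generically_and (generically_and good_c good_r)
                                        (generically_and good_rf good_cg)).
move=> X tX [[[tY eX mX] [tZ eX' mX']] [[tW1 eY mY] [tW2 eZ mZ]]] /=.
have [u mu] := PR_colsP tX tY eX mX; have [v mv] := PR_rowsP tX tZ eX' mX'.
have [v' mv'] := PR_rowsP tY tW1 eY mY; have [u' mu'] := PR_colsP tZ tW2 eZ mZ.
exact: moves_commute ii' jj' tX tY tZ eY eZ mu mv' mv mu'.
Qed.

Theorem theorem3p6 (K : realType) (n m : nat) (n_ge1 : (1 <= n)%N)
    (m_ge1 : (1 <= m)%N)
    (rho : 'S_m -> 'M[K[i]]_(n, m) -> 'M[K[i]]_(n, m))
    (sigma : 'S_n -> 'M[K[i]]_(n, m) -> 'M[K[i]]_(n, m)) :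
  column_action rho -> row_action sigma ->
  forall (s : 'S_n) (t : 'S_m),
    ratmap_eq (sigma s \o rho t) (rho t \o sigma s).
Proof.
move=> rhoP sigP s t; apply: ratmap_commute_sym.
have [[bir_rho _ _] _] := rhoP; have [[bir_sig _ _] _] := sigP.
apply: (action_commute sigP.1 (bir_rho t)) => j j' jj'.
apply: ratmap_commute_sym.
apply: (action_commute rhoP.1 (bir_sig _)) => i i' ii'.
exact: generators_commute.
Qed.
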